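(* Let $k\ge 1$ and $n\ge 0$ be integers. The set of $k$-Stirling permutations of size $n+1$ (equivalently, the set of $(k+1)$-ary increasing trees of size $n+1$) is in bijection with the set of path diagrams of length $n$ built on the step vectors $a_1,\dots,a_k,b,c$ with possibility function $\mathrm{pos}(a_{j,\ell})=\binom{k+1}{\ell+1}(j+1)$ for $1\le\ell\le k$, $\mathrm{pos}(b_j)=j+1$, $\mathrm{pos}(c_j)=(k+1)(j+1)$, for all $j\ge 0$.
   Context: A $k$-Stirling permutation of size $m$ is a permutation of the multiset $\{1^k,\dots,m^k\}$ such that for each $i$, all entries between two occurrences of $i$ are at least $i$. A $(k+1)$-ary increasing tree of size $m$ is a rooted tree on nodes $\{1,\dots,m\}$, each node having $k+1$ distinguishable ordered child positions (each occupied or vacant), with labels increasing along paths from the root. Step vectors: rises $a_\ell=(1,\ell)$ for $1\le\ell\le k$, fall $b=(1,-1)$, level $c=(1,0)$. A word $u=u_1\cdots u_n$ over $\{a_1,\dots,a_k,b,c\}$ determines points $M_0=(0,0)$, $M_j=M_{j-1}+u_j$; only paths with all points having nonnegative $y$-coordinate and $M_n=(n,0)$ (i.e. ending at height $0$) are considered. Writing $M_j=(j,y_j)$, the labelled path $\lambda(u)=v_1\cdots v_n$ is defined by $v_j=a_{y_{j-1},\ell}$ if $u_j=a_\ell$, $v_j=b_{y_{j-1}}$ if $u_j=b$, $v_j=c_{y_{j-1}}$ if $u_j=c$. A path diagram of length $n$ with possibility function $\mathrm{pos}$ is a pair $(\lambda(u),s)$ where $\lambda(u)=v_1\cdots v_n$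 is such a labelled path and $s=s_1\cdots s_n$ is a sequence of integers with $0\le s_j<\mathrm{pos}(v_j)$ for all $j$. *)

(* Defs.v *)
From mathcomp Require Import all_boot all_order all_algebra.
From mathcomp Require Import classical_sets functions.

Set Implicit Arguments.
Unset Strict Implicit.
Unset Printing Implicit Defensive.

Import GRing.Theory Num.Theory.

Local Open Scope classical_set_scope.

Definition stirling_perm (k m : nat) : set (seq nat) :=
  [set w | perm_eq w (flatten [seq nseq k i | i <- iota 1 m]) /\
    forall p q r, p < q < r -> r < size w ->
      nth 0 w p = nth 0 w r -> nth 0 w p <= nth 0 w q].

(* A child position is either vacant or holds a labelled node; the node itself
   carries its k+1 ordered child positions. *)
Inductive tree (k : nat) : Type :=
  | Vacant
  | Node of nat & tree k ^ k.+1.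

Arguments Vacant {k}.

Fixpoint labels k (t : tree k) : seq nat :=
  if t is Node i f then i :: flatten [seq labels (f p) | p <- enum 'I_k.+1]
  else [::].

Definition label_lt k (i : nat) (t : tree k) : bool :=
  if t is Node j _ then i < j else true.

Fixpoint increasing k (t : tree k) : Prop :=
  if t is Node i f then forall p, label_lt i (f p) /\ increasing (f p)
  else True.

(* For m >= 1 the condition on the labels excludes the empty tree [Vacant]. *)
Definition increasing_tree (k m : nat) : set (tree k) :=
  [set t | perm_eq (labels t) (iota 1 m) /\ increasing t].

Arguments increasing_tree : clear implicits.

(* [Rise l] is a_l, [Fall] is b, [Level] is c. *)
Inductive step : Type := Rise of nat | Fall | Level.

Definition letter (k : nat) (x : step) : bool :=
  if x is Rise l then 1 <= l <= k else true.

Definition vec (x : step) : int * int :=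
  match x with
  | Rise l => (1%R, l%:Z%R)
  | Fall => (1%R, (-1)%R)
  | Level => (1%R, 0%R)
  end.

Definition path_point (u : seq step) (j : nat) : int * int :=
  (\sum_(x <- take j u) vec x)%R.

Definition lattice_path (k n : nat) : set (seq step) :=
  [set u | [/\ size u = n, all (letter k) u,
    forall j, j <= n -> (0 <= (path_point u j).2)%R & path_point u n = (n%:Z%R, 0%R)]].

(* [LRise j l] is a_{j,l}, [LFall j] is b_j, [LLevel j] is c_j. *)
Inductive lstep : Type := LRise of nat & nat | LFall of nat | LLevel of nat.

Definition lab (y : nat) (x : step) : lstep :=
  match x with
  | Rise l => LRise y l
  | Fall => LFall y
  | Level => LLevel y
  end.

(* Positions are 0-based: the letter at position j starts at the point M_j.
   The absolute value only converts from int to nat, since heights are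
   nonnegative on lattice paths. *)
Definition labelled (u : seq step) : seq lstep :=
  mkseq (fun j => lab (absz (path_point u j).2) (nth Level u j)) (size u).

(* [all2] forces both sequences to have the same length. *)
Definition path_diagram (k n : nat) (pos : lstep -> nat) :
    set (seq lstep * seq nat) :=
  [set d | (exists2 u, lattice_path k n u & d.1 = labelled u) /\
    all2 (fun v s => s < pos v) d.1 d.2].

Definition stirling_pos (k : nat) (v : lstep) : nat :=
  match v with
  | LRise j l => 'C(k.+1, l.+1) * j.+1
  | LFall j => j.+1
  | LLevel j => k.+1 * j.+1
  end.

(* Main.v *)
(* All three families have [\prod_(i <= n) (1 + k * i)] members. The copies of
   the largest letter m+1 of a k-Stirling permutation form a block, which can be
   inserted at any of the k m + 1 places of a permutation of size m. In a
   forest of [a] possibly vacant trees, the least label is one of the [a] roots,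
   and removing it leaves a forest of a + k trees. A path diagram at height y
   describes y + 1 open slots of a tree being built from the root: a step picks
   a slot, puts a node there and opens i of its k+1 child positions, in
   'C(k+1, i) (y+1) ways, moving the height by i - 1. Summing over the set of
   open slots among [a] ones, Vandermonde's convolution shows that
   \sum_y 'C(a, y) walks(y) satisfies the same recurrence as the forests. *)
From HB Require Import structures.
Require Import Defs.
From mathcomp Require Import all_boot all_order all_algebra.
From mathcomp Require Import boolp classical_sets functions.
From mathcomp Require Import zify.

Set Implicit Arguments.
Unset Strict Implicit.
Unset Printing Implicit Defensive.

Import GRing.Theory Num.Theory.

Local Open Scope nat_scope.

(** * Finite sets of prescribed size and the sum and product rules for them *)

Definition counted (T : eqType) (A : set T) (N : nat) : Prop :=
  exists s : seq T, [/\ uniq s, size s = N & forall x, A x <-> x \in s].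

(** The two enumerations are matched position by position; [d] is the value of the total function
    outside [A]. *)
Lemma counted_bij (T U : eqType) (d : U) (A : set T) (B : set U) N :
  counted A N -> counted B N -> exists f : T -> U, set_bij A B f.
Proof.
move=> [s [us ss As]] [t [ut st Bt]].
exists (fun x => nth d t (index x s)); split.
- by move=> x /As xs; apply/Bt; rewrite mem_nth // st -ss index_mem.
- move=> x y /set_mem/As xs /set_mem/As ys /eqP.
  rewrite nth_uniq ?st -?ss ?index_mem // => /eqP e.
  by rewrite -(nth_index x xs) e nth_index.
- move=> y /Bt yt.
  (* [nth] on [s] needs a default in [T]: one exists because [s] is as long as [t], which contains
     [y]. *)
  have x0 : T by case: s ss {us As} => [|//]; case: t st yt {ut Bt} => //= ? ? <-.
  have lt : index y t < size s by rewrite ss -st index_mem.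
  exists (nth x0 s (index y t)); first by apply/As; rewrite mem_nth.
  by rewrite index_uniq // nth_index.
Qed.

Lemma counted_eq (T : eqType) (A B : set T) N :
  (forall x, A x <-> B x) -> counted A N -> counted B N.
Proof.
by move=> AB [s [us ss As]]; exists s; split=> // x; rewrite -AB.
Qed.

Lemma counted_mul (T U : eqType) (A : set T) (B : set U) (f : nat -> T -> U) c N :
    counted A N ->
    (forall i x, i < c -> A x -> B (f i x)) ->
    (forall i j x y, i < c -> j < c -> A x -> A y -> f i x = f j y ->
       i = j /\ x = y) ->
    (forall y, B y -> exists i x, [/\ i < c, A x & f i x = y]) ->
  counted B (c * N).
Proof.
move=> [s [us ss As]] fB finj fsurj.
exists [seq f i x | i <- iota 0 c, x <- s]; split.
- apply: allpairs_uniq => //; first exact: iota_uniq.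
  move=> [i x] [j y] /allpairsP [[i1 x1] /= [+ xs [-> ->]]].
  rewrite mem_iota add0n /= => ic.
  move=> /allpairsP [[i2 x2] /= [+ ys [-> ->]]].
  rewrite mem_iota add0n /= => jc e.
  by have [-> ->] := finj _ _ _ _ ic jc (iffRL (As _) xs) (iffRL (As _) ys) e.
- by rewrite size_allpairs size_iota ss.
- move=> y; split.
    move=> /fsurj [i [x [ic /As xs <-]]].
    by apply/allpairsP; exists (i, x); rewrite mem_iota.
  move=> /allpairsP [[i x] /= [+ /As xs ->]].
  by rewrite mem_iota add0n /= => ic; apply: fB.
Qed.

Lemma counted_sum (T : eqType) (A : nat -> set T) (N : nat -> nat) m :
    (forall i, i < m -> counted (A i) (N i)) ->
    (forall i j x, A i x -> A j x -> i = j) ->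
  counted [set x | exists2 i, i < m & A i x] (\sum_(i < m) N i).
Proof.
move=> cA dA; elim: m cA => [|m IH] cA.
  by exists [::]; rewrite big_ord0; split=> // x; split=> [[]|].
have [|s [us ss As]] := IH; first by move=> i im; apply/cA/ltnW.
have [t [ut st At]] := cA m (ltnSn m).
exists (s ++ t); split.
- rewrite cat_uniq us ut andbT /=; apply/hasPn => x /At Am.
  by apply/negP => /As [i im /dA /(_ Am) im']; rewrite im' ltnn in im.
- by rewrite size_cat ss st big_ord_recr.
- move=> x; rewrite mem_cat; split.
    move=> [i]; rewrite ltnS leq_eqVlt => /orP [/eqP -> /At ->|im Ai].
      by rewrite orbT.
    by apply/orP; left; apply/As; exists i.
  case/orP => [/As [i im Ai]|/At Am]; last by exists m.
  by exists i => //; apply: ltnW.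
Qed.

(** * The common count and its expression through weighted walks *)

(** The rising factorial with increment [k], i.e. a (a + k) ... (a + (N - 1) k). *)
Definition ksteps (k N a : nat) : nat := \prod_(i < N) (a + k * i).

(** Peeling off the first factor matches the removal of a root from a forest; [kstepsSr] peels off
    the last one, which matches the insertion of the largest block. *)
Lemma kstepsS k N a : ksteps k N.+1 a = a * ksteps k N (a + k).
Proof.
rewrite /ksteps big_ord_recl muln0 addn0; congr (_ * _).
by apply: eq_bigr => i _; rewrite /bump /= ?add1n mulnS addnA.
Qed.

Lemma kstepsSr k N a : ksteps k N.+1 a = (k * N + a) * ksteps k N a.
Proof. by rewrite /ksteps big_ord_recr /= mulnC addnC. Qed.

(** The argument [y] is the number of open slots, one more than the height, so a walk ends at 1. The
    factor [y] gives weight 0 to walks that have dropped below the axis. *)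
Fixpoint walks (k n y : nat) : nat :=
  if n is n'.+1 then y * \sum_(i < k.+2) 'C(k.+1, i) * walks k n' (y + i).-1
  else y == 1.

(** Pascal's rule, summed against [F]. *)
Lemma binomial_transformS m (F : nat -> nat) :
  \sum_(i < m.+2) 'C(m.+1, i) * F i =
  \sum_(i < m.+1) 'C(m, i) * F i + \sum_(i < m.+1) 'C(m, i) * F i.+1.
Proof.
rewrite big_ord_recl /= bin0.
under eq_bigr => i _ do rewrite /bump /= ?add1n binS mulnDl.
rewrite big_split /= addnA; congr (_ + _).
rewrite [RHS]big_ord_recl bin0 big_ord_recr /= bin_small // mul0n addn0.
by congr (_ + _); apply: eq_bigr.
Qed.

(* Vandermonde's convolution, as the composition law of binomial transforms *)
Lemma binomial_transformD m r (F : nat -> nat) :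
  \sum_(y < m.+1) 'C(m, y) * (\sum_(i < r.+1) 'C(r, i) * F (y + i)) =
  \sum_(y < (m + r).+1) 'C(m + r, y) * F y.
Proof.
elim: m F => [|m IH] F; first by rewrite big_ord1 bin0 mul1n.
rewrite (binomial_transformS _ (fun y => \sum_(i < r.+1) 'C(r, i) * F (y + i))).
(* The induction hypothesis serves both [F] and its shift, and Pascal's rule reassembles the two
   sums. *)
by rewrite IH (IH (fun y => F y.+1)) addSn binomial_transformS.
Qed.

(** Both sides obey the recurrence that pulls out a factor [a] and replaces [a] by [a + k]. The
    binomial coefficient chooses which of the [a] slots are open. *)
Lemma ksteps_walks k n a :
  ksteps k n.+1 a = \sum_(y < a.+1) 'C(a, y) * walks k n y.
Proof.
elim: n a => [|n IH] [|a].
- by rewrite kstepsS big_ord1.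
- rewrite kstepsS /ksteps big_ord0 !big_ord_recl /= bin1 big1 //=; lia.
- by rewrite kstepsS big_ord1.
rewrite kstepsS IH [RHS]big_ord_recl /= mul0n muln0 add0n.
(* Vandermonde is read backwards, with the [a + k.+1] slots split as [a] old ones and the [k.+1]
   child positions of the new node. *)
transitivity (a.+1 * \sum_(y < a.+1) 'C(a, y) *
    \sum_(i < k.+2) 'C(k.+1, i) * walks k n (y + i)).
  by rewrite binomial_transformD -addSnnS.
rewrite big_distrr; apply: eq_bigr => y _ /=.
(* Absorption: (a + 1) C(a, y) = (y + 1) C(a + 1, y + 1). *)
by rewrite /bump /= ?add1n !mulnA mul_bin_diag [in RHS](mulnC 'C(_, _)).
Qed.

Lemma walks0 k n : walks k n 0 = 0.
Proof. by case: n. Qed.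

Lemma walks1 k n : walks k n 1 = ksteps k n.+1 1.
Proof.
by rewrite ksteps_walks !big_ord_recl big_ord0 /= walks0 muln0 addn0 mul1n.
Qed.

(** * Stirling permutations *)

Lemma subseq_cons_nth (T : eqType) (x0 a : T) (s w : seq T) :
  subseq (a :: s) w ->
  exists p, [/\ p < size w, nth x0 w p = a & subseq s (drop p.+1 w)].
Proof.
elim: w => [|e w IH] //=; case: eqVneq => [<-|_] sw.
  by exists 0; rewrite drop0.
by have [p [pw pa sp]] := IH sw; exists p.+1.
Qed.

Lemma subseq3P (T : eqType) (x0 a b c : T) (w : seq T) :
  subseq [:: a; b; c] w <->
  exists p q r, [/\ p < q < r, r < size w &
    [/\ nth x0 w p = a, nth x0 w q = b & nth x0 w r = c]].
Proof.
split.
  move=> /(subseq_cons_nth x0) [p [pw pa]].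
  move=> /(subseq_cons_nth x0) [q [qw qb]].
  rewrite drop_drop => /(subseq_cons_nth x0) [r [rw rc _]].
  move: qw qb rw rc; rewrite !size_drop !nth_drop => qw qb rw rc.
  (* Each position was found relative to a suffix, so the lengths dropped before it are added
     back. *)
  by exists p, (p.+1 + q), (q.+1 + p.+1 + r); split; [lia|lia|split].
move=> [p [q [r [/andP [pq qr] rw [<- <- <-]]]]].
have qw : q < size w := ltn_trans qr rw.
rewrite -[X in subseq _ X](cat_take_drop q) (drop_nth x0) //.
(* The first letter is found before position [q], the other two from [q] on. *)
apply: (@cat_subseq _ [:: _]).
  by rewrite sub1seq -(nth_take x0 pq) mem_nth // size_takel // ltnW.
rewrite /= eqxx sub1seq -(subnKC qr) -nth_drop mem_nth // size_drop; lia.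
Qed.

(** Stating the condition by subsequences instead of positions makes it pass to subwords at once. *)
Definition stirling (w : seq nat) : Prop :=
  forall a b, subseq [:: a; b; a] w -> a <= b.

Lemma stirling_permE k m w :
  stirling_perm k m w <->
  perm_eq w (flatten [seq nseq k i | i <- iota 1 m]) /\ stirling w.
Proof.
split=> -[wp ws]; split=> //.
  move=> a b /(subseq3P 0) [p [q [r [pqr rw [<- <- e]]]]].
  exact: ws pqr rw (esym e).
move=> p q r pqr rw e; apply: ws; apply/(subseq3P 0).
by exists p, q, r.
Qed.

Lemma stirling_subseq w w' : subseq w w' -> stirling w' -> stirling w.
Proof. by move=> ww' sw a b abw; apply: sw; apply: subseq_trans ww'. Qed.

Lemma subseq_catr_notin (T : eqType) (a : T) s x y :
  a \notin x -> subseq (a :: s) (x ++ y) -> subseq (a :: s) y.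
Proof.
elim: x => [|b x IH] //=; rewrite inE negb_or => /andP [ab ax].
by rewrite (negPf ab) => /IH; apply.
Qed.

Definition insert_block k M p (w : seq nat) : seq nat :=
  take p w ++ nseq k M ++ drop p w.

Lemma filter_insert_block k M p w :
  M \notin w -> filter (predC1 M) (insert_block k M p w) = w.
Proof.
move=> Mw; rewrite /insert_block !filter_cat filter_nseq /= eqxx /=.
by rewrite -filter_cat cat_take_drop; apply/all_filterP/allP => x xw /=; apply: contraNneq Mw => <-.
Qed.

(** The insertion place is recovered as the first occurrence of [M], the block being nonempty;
    [filter_insert_block] recovers the word. Together they make insertion injective. *)
Lemma index_insert_block k M p w :
  0 < k -> M \notin w -> p <= size w -> index M (insert_block k M p w) = p.
Proof.
case: k => // k _ Mw pw; rewrite /insert_block index_cat /= eqxx addn0.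
rewrite ifN; first by rewrite size_takel.
by apply: contra Mw; apply: mem_take.
Qed.

(** A pattern [a b a] with [b] equal to [M] is harmless by maximality, one avoiding [M] already
    occurs in [w], and one with only [a] equal to [M] cannot occur in a contiguous block. *)
Lemma stirling_insert_block k M p w :
  M \notin w -> all (geq M) w -> stirling w -> stirling (insert_block k M p w).
Proof.
move=> Mw wM sw a b abw.
have Mtake : M \notin take p w by apply: contra Mw; apply: mem_take.
have Mdrop : M \notin drop p w by apply: contra Mw; apply: mem_drop.
have le x : x \in insert_block k M p w -> x <= M.
  rewrite !mem_cat orbCA -mem_cat cat_take_drop => /orP [|/(allP wM)] //.
  by case/nseqP => -> _.
have [bM|bM] := eqVneq b M.
  by rewrite bM le // (mem_subseq abw) // inE eqxx.
have [aM|aM] := eqVneq a M; last first.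
  by apply: sw; rewrite -(filter_insert_block k p Mw) subseq_filter /= aM bM.
(* The pattern starts after [take p w]. Without its first letter it starts with [b], which is not in
   the block, so its last [M] would lie in [drop p w]. *)
move: abw; rewrite {}aM => /(subseq_catr_notin Mtake) /(subseq_trans (subseq_cons _ _)).
have bk : b \notin nseq k M by rewrite mem_nseq negb_and bM orbT.
move=> /(subseq_catr_notin bk) /mem_subseq /(_ M).
by rewrite !inE eqxx orbT (negPf Mdrop) => /(_ isT).
Qed.

(** Once a smaller letter [e] follows [M], no further [M] can occur, since the pattern [M e M] would
    force [M <= e]. *)
Lemma stirling_max_head M z :
  stirling (M :: z) -> all (geq M) z ->
  M :: z = nseq (count_mem M z).+1 M ++ filter (predC1 M) z.
Proof.
elim: z => [|e z IH] //= sMz /andP [eM zM].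
have [eqM|neM] := eqVneq e M.
  rewrite {1}eqM add1n /=; congr (_ :: _); apply: IH => //.
  apply: stirling_subseq (subseq_cons (M :: z) e) _.
  by move: sMz; rewrite eqM.
have Mz : M \notin z.
  apply/negP => Mz; have : M <= e by apply: sMz; rewrite /= !eqxx sub1seq.
  by move=> Me; case/eqP: neM; apply/eqP; rewrite eqn_leq eM.
by rewrite (count_memPn Mz) /= (all_filterP _) //; apply/allP => x xz /=; apply: contraNneq Mz => <-.
Qed.

(** The copies of a largest letter are adjacent, so deleting them and reinserting a block at their
    first position restores the word. *)
Lemma insert_block_filter M w :
  stirling w -> all (geq M) w ->
  insert_block (count_mem M w) M (index M w) (filter (predC1 M) w) = w.
Proof.
elim: w => [|e w IH] //= sw /andP [eM wM].
have [eqM|neM] := eqVneq e M; last first.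
  rewrite /insert_block /= add0n; congr (_ :: _); apply: IH => //.
  exact: stirling_subseq (subseq_cons w e) sw.
by move: sw; rewrite eqM /insert_block /= take0 drop0 => /stirling_max_head /(_ wM).
Qed.

(** All letters before the first [x] survive the filter, so its index is a legitimate insertion
    place. *)
Lemma index_le_filter (T : eqType) (x : T) (w : seq T) :
  index x w <= size (filter (predC1 x) w).
Proof. by elim: w => [|y w IH] //=; case: eqVneq. Qed.

Definition stirling_letters k m : seq nat := flatten [seq nseq k i | i <- iota 1 m].

Lemma stirling_lettersS k m :
  stirling_letters k m.+1 = stirling_letters k m ++ nseq k m.+1.
Proof. by rewrite /stirling_letters -{1}(addn1 m) iotaD map_cat flatten_cat /= cats0 add1n. Qed.

Lemma size_stirling_letters k m : size (stirling_letters k m) = k * m.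
Proof.
by elim: m => [|m IH]; rewrite ?muln0 // stirling_lettersS size_cat IH size_nseq mulnS addnC.
Qed.

Lemma stirling_letters_le k m i : i \in stirling_letters k m -> i <= m.
Proof. by case/flatten_mapP => j; rewrite mem_iota => jm /nseqP [-> _]; lia. Qed.

Lemma counted_stirling_perm k m :
  0 < k -> counted (stirling_perm k m) (ksteps k m 1).
Proof.
move=> k0; elim: m => [|m IH].
  exists [:: [::]]; rewrite /ksteps big_ord0; split=> // w; rewrite stirling_permE.
  by rewrite inE; split=> [[/perm_nilP ->]|/eqP ->].
have letters w : stirling_perm k m w ->
    [/\ perm_eq w (stirling_letters k m), stirling w, m.+1 \notin w, all (geq m.+1) w & size w = k * m].
  case/stirling_permE => wp sw; split => //.
  - by rewrite (perm_mem wp); apply/negP => /stirling_letters_le; rewrite ltnn.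
  - apply/allP => x; rewrite (perm_mem wp) => /stirling_letters_le; exact: leqW.
  - by rewrite (perm_size wp) size_stirling_letters.
(* A word of length [k * m] has [(k * m).+1] insertion places. *)
rewrite kstepsSr addn1.
apply: (counted_mul (f := insert_block k m.+1) IH).
- move=> p w _ /letters [wp sw Mw wM _]; apply/stirling_permE; split.
    rewrite -/(stirling_letters k m.+1) stirling_lettersS /insert_block.
    by rewrite perm_catCA perm_catC cat_take_drop perm_cat2r.
  exact: stirling_insert_block.
- move=> p q w v pm qm /letters [_ _ Mw _ sw] /letters [_ _ Mv _ sv] e; split.
    rewrite -(index_insert_block (k := k) k0 Mw (p := p)) ?sw //.
    by rewrite e index_insert_block ?sv.
  by rewrite -(filter_insert_block k p Mw) e filter_insert_block.
- move=> w /stirling_permE [wp sw].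
  have cw : count_mem m.+1 w = k.
    move/permP: wp => ->; rewrite -/(stirling_letters k m.+1) stirling_lettersS count_cat count_nseq /= eqxx mul1n.
    rewrite (count_memPn _) //; apply/negP => /stirling_letters_le; by rewrite ltnn.
  have fw : perm_eq (filter (predC1 m.+1) w) (stirling_letters k m).
    move/(perm_filter (predC1 m.+1)): wp; rewrite -/(stirling_letters k m.+1).
    rewrite stirling_lettersS filter_cat filter_nseq /= eqxx cats0.
    rewrite (all_filterP (s := stirling_letters k m) _) //.
    by apply/allP => x /stirling_letters_le /= xm; rewrite neq_ltn ltnS xm.
  exists (index m.+1 w), (filter (predC1 m.+1) w); split.
  + by rewrite ltnS -(size_stirling_letters k m) -(perm_size fw) index_le_filter.
  + apply/stirling_permE; split=> //; apply: stirling_subseq sw; exact: filter_subseq.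
  + rewrite -{1}cw insert_block_filter //; apply/allP => x.
    by rewrite (perm_mem wp) => /stirling_letters_le.
Qed.

(** * Increasing trees *)

(** Equality of trees is decided classically, so that trees can be enumerated in sequences. *)
HB.instance Definition _ (k : nat) := gen_eqMixin (tree k).

(** Supplies an induction hypothesis for every child stored in the finite function. *)
Fixpoint tree_nested_ind k (P : tree k -> Prop) (P0 : P Vacant)
    (PN : forall i (f : tree k ^ k.+1), (forall p, P (f p)) -> P (Node i f)) (t : tree k) : P t :=
  match t with
  | Vacant => P0
  | Node i f => PN i f (fun p => tree_nested_ind P0 PN (f p))
  end.

Definition has_root k (c : nat) (t : tree k) : bool :=
  if t is Node i _ then i == c else false.

Definition children k (t : tree k) : seq (tree k) :=
  if t is Node _ f then [seq f p | p <- enum 'I_k.+1] else [::].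

Arguments children : simpl never.

Definition graft k (c : nat) (s : seq (tree k)) : tree k :=
  Node c [ffun p : 'I_k.+1 => nth Vacant s p].

Definition forest_labels k (s : seq (tree k)) : seq nat := flatten (map (@labels k) s).

Definition forest k (c N a : nat) : set (seq (tree k)) :=
  [set s | [/\ size s = a, perm_eq (forest_labels s) (iota c N) &
    forall t, t \in s -> increasing t]].

Lemma childrenK k c (s : seq (tree k)) : size s = k.+1 -> children (graft c s) = s.
Proof.
move=> ss; rewrite /children /=; under eq_map => p do rewrite ffunE.
by rewrite (map_comp (nth Vacant s) val) val_enum_ord -ss map_nth_iota0 // take_size.
Qed.

Lemma graftK k c (f : tree k ^ k.+1) : graft c (children (Node c f)) = Node c f.
Proof.
rewrite /graft; congr Node; apply/ffunP => p; rewrite ffunE /=.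
by rewrite (nth_map p) ?size_enum_ord // nth_ord_enum.
Qed.

Lemma labels_Node k i (f : tree k ^ k.+1) :
  labels (Node i f) = i :: forest_labels (children (Node i f)).
Proof. by rewrite /forest_labels /children -map_comp. Qed.

Lemma forest_labels_cons k t (s : seq (tree k)) :
  forest_labels (t :: s) = labels t ++ forest_labels s.
Proof. by []. Qed.

Lemma forest_labels_cat k (s1 s2 : seq (tree k)) :
  forest_labels (s1 ++ s2) = forest_labels s1 ++ forest_labels s2.
Proof. by rewrite /forest_labels map_cat flatten_cat. Qed.

Lemma increasing_Node k i (f : tree k ^ k.+1) :
  increasing (Node i f) <->
  forall t, t \in children (Node i f) -> label_lt i t /\ increasing t.
Proof.
split=> /= ft; first by move=> t /mapP [p _ ->]; exact: ft.
by move=> p; apply: ft; rewrite map_f // mem_enum.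
Qed.

(** Labels increase along every path from the root; this forces the least label of a forest to sit
    at a root. *)
Lemma increasing_root_min k i (f : tree k ^ k.+1) j :
  increasing (Node i f) -> j \in labels (Node i f) -> i <= j.
Proof.
move: {-2}(Node i f) (erefl (Node i f)) => t.
elim/tree_nested_ind: t i f => [|i' f' IH] i f //= [<- _] inc.
rewrite inE => /orP [/eqP -> //|/flatten_mapP [p _]].
have [] := inc p; case: (f' p) (IH p) => [|i1 f1] //= IHp ii1 inc1 jp.
exact/(leq_trans (ltnW ii1))/(IHp _ _ erefl inc1).
Qed.

(** Removes the root at place [p] and puts its child positions, vacant ones included, in its place.
    [graft_at] is the reverse move, gathering [k.+1] consecutive trees under a new root. *)
Definition split_at k p (s : seq (tree k)) : seq (tree k) :=
  take p s ++ children (nth Vacant s p) ++ drop p.+1 s.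

Definition graft_at k c p (s : seq (tree k)) : seq (tree k) :=
  take p s ++ graft c (take k.+1 (drop p s)) :: drop (p + k.+1) s.

Lemma size_children k c (f : tree k ^ k.+1) : size (children (Node c f)) = k.+1.
Proof. by rewrite size_map size_enum_ord. Qed.

Lemma graft_atK k c p (s : seq (tree k)) :
  p + k.+1 <= size s -> split_at p (graft_at c p s) = s.
Proof.
move=> ps; have sp : size (take p s) = p by rewrite size_takel //; lia.
rewrite /split_at /graft_at take_cat drop_cat nth_cat sp ltnn subnn take0 cats0.
rewrite ltnNge leqnSn /= subSnn /= drop0 childrenK; last first.
  by rewrite size_takel // size_drop; lia.
by rewrite addnC -drop_drop !cat_take_drop.
Qed.

Lemma split_atK k c p (s : seq (tree k)) :
  p < size s -> has_root c (nth Vacant s p) -> graft_at c p (split_at p s) = s.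
Proof.
move=> ps; case e: (nth Vacant s p) => [|i f] //= /eqP ic; subst i.
have sp : size (take p s) = p by rewrite size_takel // ltnW.
rewrite /split_at /graft_at e.
rewrite take_cat sp ltnn subnn take0 cats0.
rewrite (drop_cat p) sp ltnn subnn drop0 -{1}(size_children c f) take_size_cat //.
rewrite graftK drop_cat sp ltnNge leq_addr /= addnC addnK.
rewrite -{1}(size_children c f) drop_size_cat //.
by rewrite -e -drop_nth // cat_take_drop.
Qed.

Lemma forest_labels_graft_at k c p (s : seq (tree k)) :
  p + k.+1 <= size s ->
  perm_eq (forest_labels (graft_at c p s)) (c :: forest_labels s).
Proof.
move=> ps; rewrite /graft_at forest_labels_cat forest_labels_cons labels_Node childrenK; last first.
  by rewrite size_takel // size_drop; lia.
rewrite cat_cons -cat1s perm_catCA perm_cons -!forest_labels_cat.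
by rewrite addnC -drop_drop !cat_take_drop.
Qed.

Lemma has_root_in_labels k c (t : tree k) : has_root c t -> c \in labels t.
Proof. by case: t => //= i f /eqP ->; rewrite inE eqxx. Qed.

(** As [c] is a new label, no tree before place [p] is rooted at it, so the place of grafting can be
    read off. *)
Lemma find_graft_at k c p (s : seq (tree k)) :
  p + k.+1 <= size s -> c \notin forest_labels s ->
  find (has_root c) (graft_at c p s) = p.
Proof.
move=> ps cs; have sp : size (take p s) = p by rewrite size_takel //; lia.
rewrite /graft_at find_cat ifN /= ?eqxx ?addn0 //.
apply: contra cs => /hasP [t /mem_take ts /has_root_in_labels ct].
by apply/flatten_mapP; exists t.
Qed.

(** Induction on the number of labels: grafting [c] at any of [a] places is a bijection from pairs
    of a place and a forest of [a + k] trees. *)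
Lemma counted_forest k c N a : counted (@forest k c N a) (ksteps k N a).
Proof.
elim: N c a => [|N IH] c a.
  exists [:: nseq a Vacant]; rewrite /ksteps big_ord0; split=> // s.
  rewrite inE; split=> [[<- /perm_nilP s0 _]|/eqP ->].
    (* A node would contribute its label to an empty list, so every entry is vacant. *)
    apply/eqP/all_pred1P/allP => -[|i f]; first by rewrite /= eqxx.
    move=> /(map_f (@labels k)) sf.
    suff : i \in forest_labels s by rewrite s0.
    by apply/flattenP; exists (labels (Node i f)) => //=; rewrite inE eqxx.
  split; first by rewrite size_nseq.
    by rewrite (_ : forest_labels _ = [::]) //; elim: (a).
  by move=> t /nseqP [-> _].
rewrite kstepsS.
have notin (s : seq (tree k)) : forest c.+1 N (a + k) s -> c \notin forest_labels s.
  by case=> _ sl _; rewrite (perm_mem sl) mem_iota ltnn.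
apply: (counted_mul (f := graft_at c) (IH c.+1 (a + k))).
- move=> p s pa [ss sl si].
  have ps : p + k.+1 <= size s by rewrite ss; lia.
  have sp : size (take p s) = p by rewrite size_takel //; lia.
  split.
  + by rewrite /graft_at size_cat sp /= size_drop ss; lia.
  + by rewrite (perm_trans (forest_labels_graft_at c ps)) //= perm_cons.
  + move=> t; rewrite mem_cat inE orbCA => /orP [/eqP ->|]; last first.
      by case/orP => [/mem_take|/mem_drop]; apply: si.
    apply/increasing_Node; rewrite -/(graft _ _) childrenK; last first.
      by rewrite size_takel // size_drop; lia.
    move=> t' /mem_take /mem_drop ts; split; last exact: si.
    case: t' ts => //= j f js.
    have : j \in forest_labels s.
      by apply/flatten_mapP; exists (Node j f); rewrite //= inE eqxx.
    by rewrite (perm_mem sl) mem_iota => /andP [].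
- move=> p q s s' pa qa As As' e.
  have ps : p + k.+1 <= size s by case: As => ->; lia.
  have qs : q + k.+1 <= size s' by case: As' => ->; lia.
  have pq : p = q.
    by rewrite -(find_graft_at ps (notin _ As)) e find_graft_at // notin.
  by split; rewrite // -(graft_atK c ps) e pq graft_atK.
- move=> s [ss sl si].
  have /flatten_mapP [t ts ct] : c \in forest_labels s.
    by rewrite (perm_mem sl) inE eqxx.
  (* The root of the tree containing [c] is at most [c], and no label is below [c]. *)
  have tc : has_root c t.
    case: t ts ct => [|i f] // ts ci; have ic := increasing_root_min (si _ ts) ci.
    rewrite /= eqn_leq ic /=.
    have : i \in forest_labels s.
      by apply/flatten_mapP; exists (Node i f); rewrite //= inE eqxx.
    by rewrite (perm_mem sl) mem_iota => /andP [].
  pose p := index t s.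
  have pa : p < size s by rewrite index_mem.
  have pa' : p < a by rewrite -ss.
  have rp : has_root c (nth Vacant s p) by rewrite nth_index.
  exists p, (split_at p s); rewrite split_atK //; split=> //.
  have sz : size (split_at p s) = a + k.
    rewrite /split_at !size_cat size_takel; last exact: ltnW.
    case: (nth _ _ _) rp => // i f _; rewrite size_children size_drop ss; lia.
  split=> //.
  + have ps : p + k.+1 <= size (split_at p s) by rewrite sz; lia.
    by rewrite -(perm_cons c) -(permPl (forest_labels_graft_at c ps)) split_atK.
  + move=> t'; rewrite !mem_cat orbCA => /orP [|]; last first.
      by case/orP => [/mem_take|/mem_drop]; apply: si.
    have : nth Vacant s p \in s by rewrite mem_nth.
    by case: (nth _ _ _) => // i f /si /increasing_Node fi /fi [].
Qed.

Lemma counted_increasing_tree k m :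
  counted (increasing_tree k m) (ksteps k m 1).
Proof.
have [s [us ss Fs]] := counted_forest k 1 m 1.
(* Trees are identified with forests of one tree; [head] unwraps them. *)
exists [seq head Vacant t | t <- s]; split; last 1 first.
- move=> t; split.
    case=> tl ti; have /Fs ts : forest 1 m 1 [:: t].
      by split=> //; [rewrite /forest_labels /= cats0|move=> t'; rewrite inE => /eqP ->].
    by apply/mapP; exists [:: t].
  case/mapP => u /Fs [su ul ui] ->; case: u su ul ui => [|t' [|]] // _.
  rewrite /forest_labels /= cats0 => ul ui.
  by split=> //; apply: ui; rewrite inE.
- rewrite map_inj_in_uniq // => u v /Fs [su _ _] /Fs [sv _ _].
  by case: u v su sv => [|x [|? ?]] [|y [|? ?]] //= _ _ ->.
- by rewrite size_map.
Qed.

(** * Path diagrams *)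

HB.instance Definition _ := gen_eqMixin lstep.

(** Paths starting at an arbitrary height [y], so that the first step can be removed in an
    induction. *)
Definition path_from (k n y : nat) (u : seq step) : Prop :=
  [/\ size u = n, all (letter k) u,
    forall j, j <= n -> (0 <= y%:Z + (path_point u j).2)%R &
    (y%:Z + (path_point u n).2 = 0)%R].

Definition labelled_from (y : nat) (u : seq step) : seq lstep :=
  mkseq (fun j => lab (absz (y%:Z + (path_point u j).2)%R) (nth Level u j)) (size u).

Lemma path_point0 u : path_point u 0 = 0%R.
Proof. by rewrite /path_point take0 big_nil. Qed.

Lemma path_pointS x u j : path_point (x :: u) j.+1 = (vec x + path_point u j)%R.
Proof. by rewrite /path_point /= big_cons. Qed.

(** Every step has first coordinate 1, so only heights matter at the endpoint. *)
Lemma path_point_fst u : (path_point u (size u)).1 = (size u)%:Z%R.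
Proof.
elim: u => [|x u IH]; first by rewrite path_point0.
by rewrite path_pointS /= IH; case: x => [l||] /=; lia.
Qed.

Lemma lattice_pathE k n u : lattice_path k n u <-> path_from k n 0 u.
Proof.
split=> -[su lu hu eu]; split=> //.
- by move=> j jn; rewrite add0r hu.
- by rewrite add0r eu.
- by move=> j /hu; rewrite add0r.
- by rewrite [LHS]surjective_pairing -{1}su path_point_fst su -[X in (_, X)]add0r eu.
Qed.

(** Heights as natural numbers; [next_vec] excludes the fall from 0, where the predecessor would
    truncate. *)
Definition next (y : nat) (x : step) : nat :=
  match x with
  | Rise l => y + l
  | Fall => y.-1
  | Level => y
  end.

Lemma next_vec y x : (0 <= y%:Z + (vec x).2)%R ->
  ((next y x)%:Z = y%:Z + (vec x).2)%R.
Proof. by case: x => [l||] /=; lia. Qed.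

Lemma labelled_from_cons y x u : (0 <= y%:Z + (vec x).2)%R ->
  labelled_from y (x :: u) = lab y x :: labelled_from (next y x) u.
Proof.
move=> yx; rewrite /labelled_from /= /mkseq /= path_point0 addr0; congr (_ :: _).
rewrite (iotaDl 1 0) -map_comp; apply: eq_map => j /=.
rewrite path_pointS /= addrA; congr (lab (absz (_ + _)%R) _).
by rewrite next_vec.
Qed.

Lemma path_from_nil k y u : path_from k 0 y u <-> u = [::] /\ y = 0.
Proof.
split=> [[/size0nil -> _ _]|[-> ->]].
  by rewrite path_point0 addr0 => -[].
by split=> // [j _|]; rewrite /path_point ?big_nil.
Qed.

Lemma path_from_cons k n y u :
  path_from k n.+1 y u <->
  exists x v, [/\ u = x :: v, letter k x, (0 <= y%:Z + (vec x).2)%R &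
    path_from k n (next y x) v].
Proof.
split.
  case: u => [|x v] [] //= [sv] /andP [lx lv] hv ev.
  have yx : (0 <= y%:Z + (vec x).2)%R.
    (* The condition at the first point after the start is exactly that the first step is
       allowed. *)
    by have := hv 1 isT; rewrite path_pointS path_point0 addr0.
  exists x, v; split=> //; split=> //.
    by move=> j jn; have := hv j.+1 jn; rewrite path_pointS next_vec //= addrA.
  by move: ev; rewrite path_pointS next_vec //= addrA.
move=> [x [v [-> lx yx [sv lv hv ev]]]]; split=> /=.
- by rewrite sv.
- by rewrite lx.
- case=> [|j] jn; first by rewrite path_point0 addr0.
  by rewrite path_pointS /= addrA -next_vec // hv.
- by rewrite path_pointS /= addrA -next_vec.
Qed.

Definition diagram_from (k n y : nat) : set (seq lstep * seq nat) :=
  [set d | (exists2 u, path_from k n y u & d.1 = labelled_from y u) /\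
    all2 (fun v s => s < stirling_pos k v) d.1 d.2].

Lemma diagram_from0 k n d :
  path_diagram k n (stirling_pos k) d <-> diagram_from k n 0 d.
Proof.
split=> -[[u /lattice_pathE pu e] ds]; split=> //; exists u => //; rewrite e.
  by apply: eq_map => j; rewrite add0r.
by apply: eq_map => j; rewrite add0r.
Qed.

(* The letter that replaces one open slot by [i]: it shifts the height by [i - 1]. *)
Definition slot_step (i : nat) : step :=
  match i with
  | 0 => Fall
  | 1 => Level
  | l.+1 => Rise l
  end.

Lemma slot_step_inj : injective slot_step.
Proof. by move=> [|[|i]] [|[|j]] //= [->]. Qed.

Lemma slot_step_letter k x : 0 < k ->
  letter k x <-> exists2 i, i < k.+2 & x = slot_step i.
Proof.
move=> k0; split=> [|[[|[|i]] ik ->] //].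
case: x => [[|l] //= lk||_]; [by exists l.+2|by exists 0|by exists 1].
Qed.

Lemma next_slot_step y i : next y (slot_step i) = (y + i).-1.
Proof. case: i => [|[|i]] /=; lia. Qed.

Lemma slot_step_ge0 y i :
  (0 <= y%:Z + (vec (slot_step i)).2)%R = (0 < y + i).
Proof. case: i => [|[|i]] /=; lia. Qed.

(** The three cases of the possibility function become one, since C(k + 1, 0) = 1 and C(k + 1, 1) =
    k + 1. *)
Lemma stirling_pos_slot_step k y i : i < k.+2 ->
  stirling_pos k (lab y (slot_step i)) = 'C(k.+1, i) * y.+1.
Proof. by case: i => [|[|i]] _ /=; rewrite ?bin0 ?bin1 ?mul1n. Qed.

Lemma lab_inj y : injective (lab y).
Proof. by move=> [l||] [m||] //= [->]. Qed.

(* A walk at height [y] has [y.+1] open slots. *)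
Lemma counted_diagram_from k n y :
  0 < k -> counted (diagram_from k n y) (walks k n y.+1).
Proof.
move=> k0; elim: n y => [|n IH] y.
  (* The empty path ends at height 0 only if it starts there. *)
  exists (if y == 0 then [:: ([::], [::])] else [::]); split.
  - by case: eqP.
  - by case: y.
  - move=> [ls ss]; split.
      case=> -[u /path_from_nil [-> ->] /= ->].
      by case: ss => // _; rewrite inE.
    case: eqP => // ->; rewrite inE => /eqP [-> ->]; split=> //.
    by exists [::] => //; apply/path_from_nil.
(* Diagrams are sorted by the number [i] of slots opened by their first step; [c] is the first
   possibility, and [0 < y + i] keeps the path from going below the axis. *)
pose step_diagrams i : set (seq lstep * seq nat) :=
  [set d | exists c s e, [/\ c < 'C(k.+1, i) * y.+1, 0 < y + i,
     diagram_from k n (y + i).-1 (s, e) &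
     d = (lab y (slot_step i) :: s, c :: e)]]%classic.
apply: (@counted_eq _ [set d | exists2 i, i < k.+2 & step_diagrams i d]).
  move=> d; split.
    move=> [i ik [c [s [e [ci yi [[u pu /= su] es] ->]]]]]; split=> /=; last first.
      by rewrite stirling_pos_slot_step // ci.
    have yx : (0 <= y%:Z + (vec (slot_step i)).2)%R by rewrite slot_step_ge0.
    exists (slot_step i :: u); last by rewrite labelled_from_cons // next_slot_step -su.
    apply/path_from_cons; exists (slot_step i), u; split=> //.
      by apply/(slot_step_letter _ k0); exists i.
    by rewrite next_slot_step.
  case: d => ls cs [[u /path_from_cons [x [v [-> lx yx pv]]] /= ->]].
  rewrite labelled_from_cons //; case: cs => //= c e /andP [cx ce].
  have [i ik xi] := (slot_step_letter x k0).1 lx; subst x.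
  exists i => //; exists c, (labelled_from (next y (slot_step i)) v), e; split=> //.
  - by rewrite -stirling_pos_slot_step.
  - by rewrite -slot_step_ge0.
  - by rewrite -next_slot_step; split=> //; exists v.
have -> : walks k n.+1 y.+1 =
    \sum_(i < k.+2) 'C(k.+1, i) * y.+1 * walks k n (y + i).
  by rewrite /= big_distrr; apply: eq_bigr => i _; rewrite /= mulnA (mulnC y.+1).
apply: (counted_sum (N := fun i => 'C(k.+1, i) * y.+1 * walks k n (y + i))); last first.
  move=> i j d [c [s [e [_ _ _ ->]]]] [c' [s' [e' [_ _ _ [+ _ _ _]]]]].
  by move=> /lab_inj /slot_step_inj.
(* If [y + i] is 0, the step is a fall from height 0: there is no diagram, and the walk count at 0
   vanishes as well. *)
move=> i ik; have [yi|] := posnP (y + i).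
  exists [::]; split=> //; first by rewrite yi walks0 muln0.
  by move=> d; split=> // -[c [s [e [_]]]]; rewrite yi.
move=> yi; rewrite -(prednK yi).
apply: (counted_mul (f := fun c d => (lab y (slot_step i) :: d.1, c :: d.2)) (IH (y + i).-1)).
- by move=> c [s e] ci de; exists c, s, e.
- by move=> c c' [s e] [s' e'] _ _ _ _ [-> -> ->].
- by move=> d [c [s [e [ci _ de ->]]]]; exists c, (s, e).
Qed.

Lemma counted_path_diagram k n :
  0 < k -> counted (path_diagram k n (stirling_pos k)) (ksteps k n.+1 1).
Proof.
(* Height 0 means one open slot, the place of the root. *)
move=> k0; rewrite -walks1.
apply: counted_eq (counted_diagram_from n 0 k0) => d.
by split=> /diagram_from0.
Qed.

Theorem theorem4 (k n : nat) (hk : 1 <= k) :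
  (exists f : seq nat -> seq lstep * seq nat,
     set_bij (stirling_perm k n.+1) (path_diagram k n (stirling_pos k)) f) /\
  (exists g : tree k -> seq lstep * seq nat,
     set_bij (increasing_tree k n.+1) (path_diagram k n (stirling_pos k)) g).
Proof.
have diagrams := counted_path_diagram n hk.
split; apply: (counted_bij ([::], [::])) diagrams.
  exact: counted_stirling_perm.
exact: counted_increasing_tree.
Qed.
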